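(* Let $\Gamma$ be a nondegenerate compact rectifiable graph having a positive curved trace. Let $E\subset\mathbb R^2$ be compact, and suppose that $E$ supports a Borel probability measure $\mu$ satisfying \[ \mu(B(x,r))\le C_\mu r^s \] for every $x\in\mathbb R^2$ and $0<r\le1$, where $0<s\le1$. Then there are constants $c>0$ and $0<\delta_0<\frac12$, depending only on the curved trace, $s$, and $C_\mu$, such that for every $0<\delta<\delta_0$, \[ \operatorname{Fav}_\Gamma(E^\delta)\ \ge\ c\,\delta^{1-s}\quad\text{if }0<s<1, \qquad \operatorname{Fav}_\Gamma(E^\delta)\ \ge\ c\left(\log\frac1\delta\right)^{-1}\quad\text{if }s=1 . \]
   Context: A nondegenerate graph is the graph $\Gamma=\{(t,\gamma(t)):t\in[a,b]\}$ of a continuous function over a compact interval of positive length; it is rectifiable if it has finite length. A compact rectifiable curve $\Gamma$ has a positive curved trace if there are a compact $C^2$ graph $\Sigma=\{(x,g(x)):x\in I\}$ ($I$ a compact interval, $g\in C^2(I)$), a compact set $A\subset\Gamma\cap\Sigma$, and $c_0>0$ with $\mathcal H^1(A)>0$ and $|g''(x)|\ge c_0$ for every $x\in I$; the data $(A,\Sigma,c_0)$ is the curved trace. For compact $E\subset\mathbb R^2$ and $\delta>0$, $E^\delta=\{x\in\mathbb R^2:\operatorname{dist}(x,E)\le\delta\}$. For compact $E$ and $\alpha\in\mathbb R$, \[ \Phi_\alpha^\Gamma(E)=\{x_2+\gamma(\alpha-x_1):(x_1,x_2)\in E,\ \alpha-x_1\in[a,b]\}, \qquad \operatorname{Fav}_\Gamma(E)=\int_{\mathbb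 R}|\Phi_\alpha^\Gamma(E)|\,d\alpha, \] where $|\cdot|$ is one-dimensional Lebesgue measure; by Fubini, $\operatorname{Fav}_\Gamma(E)=|E+\Gamma|$ (planar measure), with $E+\Gamma=\{x+y:x\in E,y\in\Gamma\}$. $B(x,r)$ is the Euclidean ball. *)

(* Defs.v *)
From HB Require Import structures.
From mathcomp Require Import all_boot all_order all_algebra.
From mathcomp Require Import all_classical all_reals all_analysis.

Set Implicit Arguments.
Unset Strict Implicit.
Unset Printing Implicit Defensive.

Import Order.TTheory GRing.Theory Num.Theory.
Import numFieldNormedType.Exports.

Local Open Scope classical_set_scope.
Local Open Scope ring_scope.

(* The plane is R * R.  Its library norm is the sup norm, so Euclidean distance
   is defined by hand; the topology is the same. *)
Definition eucl_dist (R : realType) (x y : R * R) : R :=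
  Num.sqrt ((x.1 - y.1) ^+ 2 + (x.2 - y.2) ^+ 2).

Definition eucl_ball (R : realType) (x : R * R) (r : R) : set (R * R) :=
  [set y | eucl_dist x y < r].

(* Extended-real valued, so that the distance to the empty set is +oo. *)
Definition dist_set (R : realType) (x : R * R) (E : set (R * R)) : \bar R :=
  ereal_inf [set (eucl_dist x y)%:E | y in E].

Definition thicken (R : realType) (E : set (R * R)) (delta : R) : set (R * R) :=
  [set x | (dist_set x E <= delta%:E)%E].

(* 0 is added to the set of distances because ereal_sup set0 = -oo. *)
Definition ediam (R : realType) (U : set (R * R)) : \bar R :=
  ereal_sup (0%E |` [set (eucl_dist z.1 z.2)%:E | z in U `*` U]).

Definition hausdorff1_pre (R : realType) (eps : R) (A : set (R * R)) : \bar R :=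
  ereal_inf [set (\sum_(0 <= k <oo) ediam (F k))%E
            | F in [set F : nat -> set (R * R) |
                     (forall k, (ediam (F k) <= eps%:E)%E)
                     /\ A `<=` \bigcup_k F k]].

(* hausdorff1_pre eps A increases as eps decreases to 0, so the limit is a
   supremum. *)
Definition hausdorff1 (R : realType) (A : set (R * R)) : \bar R :=
  ereal_sup [set hausdorff1_pre eps A | eps in [set eps : R | 0 < eps]].

Definition graph_on (R : realType) (a b : R) (f : R -> R) : set (R * R) :=
  [set (t, f t) | t in `[a, b]].

Definition polygon_length (R : realType) (a b : R) (f : R -> R) (s : seq R) : R :=
  let P := fun n => (nth b (a :: s) n, f (nth b (a :: s) n)) in
  \sum_(0 <= n < size s) eucl_dist (P n) (P n.+1).

(* As for [variation], a partition of [a, b] lists its points except a. *)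
Definition graph_length (R : realType) (a b : R) (f : R -> R) : \bar R :=
  ereal_sup [set (polygon_length a b f s)%:E | s in itv_partition a b].

Definition nondegenerate_graph (R : realType) (a b : R) (gamma : R -> R) : Prop :=
  a < b /\ {within `[a, b], continuous gamma}.

Definition rectifiable_graph (R : realType) (a b : R) (gamma : R -> R) : Prop :=
  (graph_length a b gamma < +oo)%E.

(* Derivatives relative to [p, q]: two-sided inside, one-sided at p and q.
   Nothing is required of f outside [p, q]. *)
Definition diff_quot (R : realType) (f : R -> R) (x : R) : R -> R :=
  fun y => (f y - f x) / (y - x).

Definition derivable_on (R : realType) (p q : R) (f : R -> R) : Prop :=
  forall x, x \in `[p, q] -> cvg (diff_quot f x @ within `[p, q] x^').

Definition derive_on (R : realType) (p q : R) (f : R -> R) : R -> R :=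
  fun x => lim (diff_quot f x @ within `[p, q] x^').

Definition C2_on (R : realType) (p q : R) (g : R -> R) : Prop :=
  [/\ derivable_on p q g, derivable_on p q (derive_on p q g)
    & {within `[p, q], continuous (derive_on p q (derive_on p q g))}].

(* p < q loses nothing: a one-point Sigma cannot carry A with H^1(A) > 0. *)
Definition curved_trace (R : realType) (Gamma A Sigma : set (R * R)) (c0 : R)
    : Prop :=
  [/\ 0 < c0, compact A, A `<=` Gamma `&` Sigma, (0 < hausdorff1 A)%E
    & exists p q g,
      [/\ p < q, C2_on p q g, Sigma = graph_on p q g
        & forall x, x \in `[p, q] ->
            c0 <= `|derive_on p q (derive_on p q g) x|]].

Definition curve_proj (R : realType) (a b : R) (gamma : R -> R)
    (E : set (R * R)) (alpha : R) : set R :=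
  [set x.2 + gamma (alpha - x.1)
  | x in [set x | E x /\ alpha - x.1 \in `[a, b]]].

Definition Fav (R : realType) (a b : R) (gamma : R -> R) (E : set (R * R))
    : \bar R :=
  (\int[lebesgue_measure]_(alpha in [set: R])
     lebesgue_measure (curve_proj a b gamma E alpha))%E.

(* The plane with the product sigma-algebra of two Borel lines, which is its
   Borel sigma-algebra. *)
Notation borel_plane R := (measurableTypeR R * measurableTypeR R)%type.

Definition supports (R : realType) (E : set (R * R))
    (mu : probability (borel_plane R) R) : Prop :=
  mu E = 1%E.

Definition upper_regular (R : realType) (mu : probability (borel_plane R) R)
    (C s : R) : Prop :=
  forall (x : R * R) (r : R), 0 < r -> r <= 1 ->
    (mu (eucl_ball x r) <= (C * r `^ s)%:E)%E.

(* Main.v *)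
Require Import Defs.
From HB Require Import structures.
From mathcomp Require Import all_boot all_order all_algebra.
From mathcomp Require Import all_classical all_reals all_analysis.
From mathcomp Require Import measurable_realfun ring lra.
Set Implicit Arguments.
Unset Strict Implicit.
Unset Printing Implicit Defensive.
Import Order.TTheory GRing.Theory Num.Theory.
Import numFieldNormedType.Exports.
Local Open Scope classical_set_scope.
Local Open Scope ring_scope.

(** The Favard length is the area of the set swept out by the translates of
    Gamma, and it is bounded below by a second moment argument.

    Let [T] be the projection of [A] to the first axis; over [T] the curve Gamma
    coincides with the graph of the [C^2] function [g].  A point [x] of the plane
    is incident to [y] when [y.1 - x.1] lies in [T] and [y] is at vertical
    distance at most [delta] from the translate by [x] of the graph of [g].  If
    the set of points incident to [y] has positive [mu]-measure, it meets [E],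
    and then a vertical shift of length at most [delta] yields a point of the
    [delta]-neighbourhood of [E] whose translate of Gamma passes through [y]
    ([incidence_curve_proj]).  So it is enough to bound from below the area of
    the set of those [y], which has to be done with three facts.

    - Each [x] is incident to an area of [2 delta |T|] ([incidence_area]), and
      [|T| > 0]: a [C^1] graph is Lipschitz, so the part of it above a null set
      is null for the one-dimensional Hausdorff measure
      ([hausdorff1_lipschitz_null]).
    - Two points [x], [x'] are incident to a common area of at most a constant
      times [delta * min (1, delta / |x - x'|)] ([incidence_overlap]).  The
      reason is transversality: as [|g''| >= c0], the difference of two
      translates of [g] whose abscissae differ by [e] has a slope of modulus at
      least [c0 |e|] ([translates_separate]), so it stays in an interval of
      length [delta] only for a time of order [delta / |e|]; and if [|e|] is
      small compared with [|x - x'|], the translates do not come near each other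
      at all, [g] being Lipschitz.
    - By the ball condition, the [mu]-integral of [min (1 / delta, 1 / |x - x'|)]
      over [x'] is bounded, up to a constant, by the sum of [2 ^ (k (1 - s))]
      over the scales [2 ^ - k >= delta], that is, by [delta ^ (s - 1)] if
      [s < 1] and by [log (1 / delta)] if [s = 1] ([integral_dyadic_kernel],
      [dyadic_energy_bound]).

    The second moment method ([second_moment]) combines them: the area is at
    least the square of the first quantity over four times the integral of the
    second one. *)

(** * Interval covers and Lebesgue measure *)

Section IntervalCovers.
Context {R : realType}.
Local Notation lam := (@lebesgue_measure R).

(** With [lebesgue_lt_cover], this reduces Lebesgue measure to covers by
    half-open intervals, without measurability assumptions. *)
Lemma lebesgue_le_cover (X : set R) (u v : nat -> R) :
  (forall k, u k <= v k) -> X `<=` \bigcup_k `]u k, v k]%classic ->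
  (lam X <= \sum_(0 <= k <oo) (v k - u k)%:E)%E.
Proof.
move=> uv Xuv; rewrite /lebesgue_measure /lebesgue_stieltjes_measure.
rewrite /measure_extension /mu_ext; apply: ereal_inf_lbound => /=.
exists (fun k => `]u k, v k]%classic).
  by split=> // k; exact: is_ocitv.
by apply: eq_eseriesr => k _; rewrite wlength_itv_bnd.
Qed.

Lemma lebesgue_lt_cover (X : set R) (e : \bar R) : (lam X < e)%E ->
  exists u v : nat -> R, [/\ forall k, u k <= v k,
    X `<=` \bigcup_k `]u k, v k]%classic &
    (\sum_(0 <= k <oo) (v k - u k)%:E < e)%E].
Proof.
rewrite /lebesgue_measure /lebesgue_stieltjes_measure /measure_extension.
move=> /ereal_inf_lt[_ /= [F [mF XF] <-] Fe].
have /choice[w Fw] : forall k, exists w : R * R,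
    w.1 <= w.2 /\ F k = `]w.1, w.2]%classic.
  move=> k; have /ocitvP[->|[w w12 ->]] := mF k; last by exists w; rewrite ltW.
  by exists (0, 0); rewrite lexx set_itvoc0.
exists (fst \o w), (snd \o w); split.
- by move=> k; case: (Fw k).
- by move=> x /XF[k _ Fkx]; exists k => //; case: (Fw k) => _ <-.
- apply: le_lt_trans Fe; rewrite le_eqVlt; apply/orP; left; apply/eqP.
  apply: eq_eseriesr => k _; case: (Fw k) => w12 ->.
  by rewrite wlength_itv_bnd.
Qed.

Lemma lebesgue_shift (X : set R) (c : R) :
  lam [set t | X (t - c)] = lam X.
Proof.
suff le_shift (Y : set R) (d : R) : (lam [set t | Y (t - d)%R] <= lam Y)%E.
  apply/eqP; rewrite eq_le le_shift /=.
  have := le_shift [set t | X (t - c)] (- c).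
  by under eq_set do rewrite /= opprK addrK.
apply/lee_addgt0Pr => e e0.
have [->|Yfin] := eqVneq (lam Y) +oo%E; first by rewrite addye// leey.
have Yfn : lam Y \is a fin_num by rewrite ge0_fin_numE ?ltey// measure_ge0.
have [u [v [uv Yuv suv]]] : exists u v : nat -> R, [/\ forall k, u k <= v k,
    Y `<=` \bigcup_k `]u k, v k]%classic &
    (\sum_(0 <= k <oo) (v k - u k)%:E < lam Y + e%:E)%E].
  by apply: lebesgue_lt_cover; rewrite lteDl// lte_fin.
apply: le_trans (ltW suv).
rewrite (@eq_eseriesr _ _ (fun k => ((v k + d) - (u k + d))%:E)); last first.
  by move=> k _; congr (_%:E); lra.
apply: lebesgue_le_cover => [k|t /= /Yuv[k _]]; first by rewrite lerD2r.
by rewrite /= !in_itv/= => utv; exists k => //=; rewrite in_itv/=; lra.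
Qed.

End IntervalCovers.

(** * Hausdorff measure of Lipschitz sets over a null set *)

Section Hausdorff.
Context {R : realType}.
Local Notation lam := (@lebesgue_measure R).

Lemma eucl_dist_le_l1 (x y : R * R) :
  eucl_dist x y <= `|x.1 - y.1| + `|x.2 - y.2|.
Proof.
rewrite -[leRHS]ger0_norm ?addr_ge0// -sqrtr_sqr; apply: ler_wsqrtr.
rewrite -[X in X + _]real_normK ?num_real// -[X in _ + X]real_normK ?num_real//.
by rewrite sqrrD addrAC lerDl mulrn_wge0// mulr_ge0.
Qed.

(** The part of [A] above an interval has diameter at most [1 + L] times the
    length of that interval, so short covers of the projection lift to short
    covers of [A]. *)
Lemma hausdorff1_lipschitz_null (A : set (R * R)) (L : R) : 0 <= L ->
  (forall x y, A x -> A y -> `|x.2 - y.2| <= L * `|x.1 - y.1|) ->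
  lam (fst @` A) = 0%E -> (hausdorff1 A <= 0)%E.
Proof.
move=> L0 lipA A0; apply: ge_ereal_sup => _ [eps /= eps0 <-].
apply/lee_addgt0Pr => e e0; rewrite add0e.
have K0 : 0 < 1 + L by rewrite ltr_wpDr.
(* covers of length [d] lift to covers of diameter and total size at most
   [eps] and [e] *)
pose d := Num.min eps e / (1 + L).
have d0 : 0 < d by rewrite divr_gt0// lt_min eps0.
have Kd : (1 + L) * d = Num.min eps e by rewrite /d mulrC divfK// gt_eqF.
have [u [v [uv Auv suv]]] : exists u v : nat -> R, [/\ forall k, u k <= v k,
    fst @` A `<=` \bigcup_k `]u k, v k]%classic &
    (\sum_(0 <= k <oo) (v k - u k)%:E < d%:E)%E].
  by apply: lebesgue_lt_cover; rewrite A0 lte_fin.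
have uv0 k : (0 <= (v k - u k)%:E)%E by rewrite lee_fin subr_ge0.
have uvd k : v k - u k <= d.
  rewrite -lee_fin; apply: le_trans (ltW suv).
  by rewrite (@nneseriesD1 _ _ k xpredT)// leeDl// nneseries_ge0.
pose F k := [set x | A x /\ u k < x.1 <= v k].
have diamF k : (ediam (F k) <= ((1 + L) * (v k - u k))%:E)%E.
  apply: ge_ereal_sup => _ [->|[[x y] [/= [Ax xuv] [Ay yuv]]] <-].
    by rewrite lee_fin mulr_ge0 ?subr_ge0// ltW.
  rewrite lee_fin (le_trans (eucl_dist_le_l1 _ _))//.
  have xy : `|x.1 - y.1| <= v k - u k by rewrite ler_norml; lra.
  rewrite mulrDl mul1r lerD// (le_trans (lipA _ _ Ax Ay))//.
  exact: ler_wpM2l.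
apply: (@le_trans _ _ (\sum_(0 <= k <oo) ediam (F k))%E).
  apply: ereal_inf_lbound; exists F => //; split.
    move=> k; apply: le_trans (diamF k) _; rewrite lee_fin.
    apply: (@le_trans _ _ ((1 + L) * d)); first by rewrite ler_pM2l.
    by rewrite Kd ge_min lexx.
  move=> x Ax; have [k _ /=] := Auv x.1 (imageP fst Ax).
  by rewrite in_itv/= => xk; exists k.
apply: (@le_trans _ _ (\sum_(0 <= k <oo) ((1 + L)%:E * (v k - u k)%:E))%E).
  apply: lee_nneseries => k _.
    by move=> _; apply: ereal_sup_ubound; left.
  by rewrite -EFinM.
rewrite nneseriesZl//; apply: (@le_trans _ _ ((1 + L)%:E * d%:E)%E).
  by rewrite lee_pmul2l ?fin_numE// ?ltW// lte_fin.
by rewrite -EFinM Kd lee_fin ge_min lexx orbT.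
Qed.

End Hausdorff.

(** * Functions differentiable on a compact interval *)

Section Extension.
Context {R : realType}.
Implicit Types (p q x t : R) (f F : R -> R).

(** Composing with [clamp p q] extends a function continuously from a compact
    interval to the whole line, where the theorems on continuity, derivatives and
    measurability apply. *)
Definition clamp p q t : R := Num.max p (Num.min q t).

Lemma clamp_itv p q t : p <= q -> clamp p q t \in `[p, q].
Proof. by move=> pq; rewrite in_itv/= /clamp le_max lexx/= ge_max pq ge_min lexx. Qed.

Lemma clamp_id p q t : t \in `[p, q] -> clamp p q t = t.
Proof. by rewrite in_itv/= => /andP[pt tq]; rewrite /clamp min_r// max_r. Qed.

Lemma continuous_clamp p q : continuous (clamp p q).
Proof.
move=> t; apply: continuous_max; first exact: cst_continuous.
by apply: continuous_min; [exact: cst_continuous|exact: id].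
Qed.

Lemma diff_quot_is_derive F x l :
  diff_quot F x y @[y --> x^'] --> l -> is_derive x 1 F l.
Proof.
move=> Fl.
have Fl' : h^-1 *: ((F \o shift x) (h *: 1) - F x) @[h --> 0^'] --> l.
  rewrite (_ : (fun h => _) = diff_quot F x \o (fun h => h + x)); last first.
    apply/funext => h; rewrite /diff_quot /= addrK mulrC.
    by rewrite /GRing.scale/= mulr1.
  apply: cvg_comp Fl => U; rewrite /nbhs/= /dnbhs/within/= => nU.
  have : (h + x) @[h --> (0 : R)] --> x.
    by rewrite -[X in _ --> X]add0r; apply: cvgD; [exact: cvg_id|exact: cvg_cst].
  move=> /(_ _ nU) hnU; apply: (@filterS _ (nbhs (0 : R)) _ _ _ _ hnU).
  move=> h /= hU h0; apply: hU.
  by rewrite -subr_eq0 addrK.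
split; first by apply/cvg_ex; exists l.
by apply: cvg_lim Fl'; exact: Rhausdorff.
Qed.

(** Away from [x], [f y] is [diff_quot f x y * (y - x) + f x], whose first term
    tends to [0]. *)
Lemma derivable_on_cvg p q f x : derivable_on p q f -> x \in `[p, q] ->
  f y @[y --> within `[p, q] (nbhs x)] --> f x.
Proof.
move=> df xpq; have /cvg_ex[l /= fl] := df x xpq.
have fx : f y @[y --> within `[p, q] x^'] --> f x.
  have -> : f x = l * (x - x) + f x by rewrite subrr mulr0 add0r.
  suff : diff_quot f x y * (y - x) + f x @[y --> within `[p, q] x^']
      --> l * (x - x) + f x.
    apply: cvg_trans; apply: near_eq_cvg.
    rewrite /prop_near1 /nbhs/= /within/=; near=> y => _.
    rewrite /diff_quot divfK ?subrK// subr_eq0.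
    by near: y; exact: nbhs_dnbhs_neq.
  apply: cvgD; last exact: cvg_cst.
  apply: cvgM => //; apply: cvgB; last exact: cvg_cst.
  apply: cvg_trans; first apply: cvg_within.
  exact: nbhs_dnbhs.
move=> U nU; have := fx U nU; rewrite /nbhs/= /within/= /dnbhs/=  => fU.
apply: (@filterS _ (nbhs x) _ _ _ _ fU) => y /= Uy ypq;
have [->|yx] := eqVneq y x; last exact: Uy.
exact: nbhs_singleton nU.
Unshelve. all: by end_near.
Qed.

Lemma derivable_on_extension p q f : p < q -> derivable_on p q f ->
  let F := f \o clamp p q in
  [/\ continuous F, forall t, t \in `[p, q] -> F t = f t &
      forall t, t \in `]p, q[ -> is_derive t 1 F (derive_on p q f t)].
Proof.
move=> pq df F; have FE t : t \in `[p, q] -> F t = f t.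
  by move=> tpq; rewrite /F/= clamp_id.
split=> // [t|t tpq].
  have ctpq : clamp p q t \in `[p, q] by apply: clamp_itv; exact: ltW.
  apply: (@cvg_comp _ _ _ (clamp p q) f _ (within `[p, q] (nbhs (clamp p q t))));
    last exact: derivable_on_cvg.
  move=> U nU; have /= cU := @continuous_clamp p q t _ nU.
  apply: (@filterS _ (nbhs t) _ _ _ _ cU) => s /=; apply.
  exact/clamp_itv/ltW.
have tpq' : t \in `[p, q] by apply: subset_itv_oo_cc tpq.
have nearI : \forall y \near t^', y \in `[p, q].
  apply: nbhs_dnbhs; apply: filterS (near_in_itvoo tpq) => y.
  exact: subset_itv_oo_cc.
have withinE : within `[p, q] t^' = t^'.
  apply/seteqP; split=> U; rewrite /within/= => FU; last first.
    by apply: filterS FU.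
  by apply: filterS2 nearI FU => y ypq; apply.
apply: diff_quot_is_derive.
have := df t tpq'; rewrite /derive_on withinE => dft.
apply: cvg_trans dft; apply: near_eq_cvg.
apply: filterS nearI => y ypq.
by rewrite /diff_quot !FE.
Qed.

End Extension.

(** * Transversality of the translates of a curved graph *)

Section CurvedFunctions.
Context {R : realType}.
Implicit Types (p q t : R).

Lemma mvt_lower p q c (f df : R -> R) : continuous f ->
  (forall t, t \in `]p, q[ -> is_derive t 1 f (df t)) ->
  (forall t, t \in `]p, q[ -> c <= `|df t|) ->
  forall u v, u \in `[p, q] -> v \in `[p, q] -> c * `|u - v| <= `|f u - f v|.
Proof.
move=> cf dfE cdf.
suff lt_case u v : u \in `[p, q] -> v \in `[p, q] -> v < u ->
    c * `|u - v| <= `|f u - f v|.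
  move=> u v upq vpq; have [uv|vu|->] := ltgtP u v; last
    by rewrite !subrr normr0 mulr0.
    by rewrite distrC [leRHS]distrC lt_case.
  exact: lt_case.
rewrite !in_itv/= => upq vpq vu.
have sub t : t \in `]v, u[ -> t \in `]p, q[ by rewrite !in_itv/=; lra.
have cfs : {within `[v, u], continuous f} by exact: continuous_subspaceT.
have [t tvu ->] := MVT vu (fun t tvu => dfE t (sub t tvu)) cfs.
by rewrite normrM ler_wpM2r// cdf// sub.
Qed.

Lemma mvt_upper p q L (f df : R -> R) : continuous f ->
  (forall t, t \in `]p, q[ -> is_derive t 1 f (df t)) ->
  (forall t, t \in `]p, q[ -> `|df t| <= L) ->
  forall u v, u \in `[p, q] -> v \in `[p, q] -> `|f u - f v| <= L * `|u - v|.
Proof.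
move=> cf dfE cdf.
suff lt_case u v : u \in `[p, q] -> v \in `[p, q] -> v < u ->
    `|f u - f v| <= L * `|u - v|.
  move=> u v upq vpq; have [uv|vu|->] := ltgtP u v; last
    by rewrite !subrr normr0 mulr0.
    by rewrite distrC [X in _ * X]distrC lt_case.
  exact: lt_case.
rewrite !in_itv/= => upq vpq vu.
have sub t : t \in `]v, u[ -> t \in `]p, q[ by rewrite !in_itv/=; lra.
have cfs : {within `[v, u], continuous f} by exact: continuous_subspaceT.
have [t tvu ->] := MVT vu (fun t tvu => dfE t (sub t tvu)) cfs.
by rewrite normrM ler_wpM2r// cdf// sub.
Qed.

Lemma continuous_bounded_itv p q (f : R -> R) : p < q -> continuous f ->
  exists2 L, 0 <= L & forall t, t \in `[p, q] -> `|f t| <= L.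
Proof.
move=> pq cf; have [|c cpq fc] := @EVT_max _ (fun t => `|f t|) p q (ltW pq).
  apply: continuous_subspaceT => t; apply: continuous_comp; first exact: cf.
  exact: norm_continuous.
by exists `|f c|.
Qed.

(** The slope of [r |-> g (r - a) - g (r - b)] is an increment of [g1] over a
    segment of length [|a - b|], hence at least [c |a - b|] in modulus by the
    mean value theorem for [g1]; the mean value theorem for this difference then
    gives the claim. *)
Lemma translates_separate p q c (g g1 g2 : R -> R) :
  continuous g -> continuous g1 ->
  (forall t, t \in `]p, q[ -> is_derive t 1 g (g1 t)) ->
  (forall t, t \in `]p, q[ -> is_derive t 1 g1 (g2 t)) ->
  (forall t, t \in `]p, q[ -> c <= `|g2 t|) ->
  forall a b t s, t - a \in `[p, q] -> t - b \in `[p, q] ->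
    s - a \in `[p, q] -> s - b \in `[p, q] ->
  c * `|a - b| * `|t - s| <= `|(g (t - a) - g (t - b)) - (g (s - a) - g (s - b))|.
Proof.
move=> cg cg1 dg dg1 cg2 a b t s.
pose h r := g (r - a) - g (r - b).
wlog st : t s / s <= t.
  move=> W ta tb sa sb; have [st|/ltW ts] := leP s t; first exact: W.
  by rewrite (distrC t) [leRHS]distrC; exact: W.
rewrite !in_itv/= => ta tb sa sb.
have ch : continuous h.
  have csh d : continuous (fun r => g (r - d)).
    move=> r; apply: (@continuous_comp _ _ _ (fun r => r - d) g); last exact: cg.
    by apply: cvgB; [exact: cvg_id|exact: cvg_cst].
  by move=> r; apply: cvgB; exact: csh.
have dh r : r \in `]s, t[ -> is_derive r 1 h (g1 (r - a) - g1 (r - b)).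
  rewrite in_itv/= => rst.
  have dsh d : p < r - d < q -> is_derive r 1 (fun r => g (r - d)) (g1 (r - d)).
    move=> rd; have rd' : r - d \in `]p, q[ by rewrite in_itv.
    rewrite -[g1 _]mulr1.
    exact: (@is_derive1_comp _ g (shift (- d)) r _ _ (dg _ rd')
      (is_derive_shift _ _ _)).
  by apply: is_deriveB; apply: dsh; lra.
have lh r : r \in `]s, t[ -> c * `|a - b| <= `|g1 (r - a) - g1 (r - b)|.
  rewrite in_itv/= => rst.
  have -> : `|a - b| = `|(r - a) - (r - b)|.
    by rewrite distrC; congr (`|_|); lra.
  by apply: (mvt_lower cg1 dg1 cg2); rewrite in_itv/=; lra.
by apply: (mvt_lower ch dh lh); rewrite in_itv/= st lexx.
Qed.

End CurvedFunctions.

(** * The second moment method *)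

Section SecondMoment.
Context {d1 d2 : measure_display} {X : measurableType d1}
  {Y : measurableType d2}.
Context {R : realType} (mu : probability X R).
Context (m : {sigma_finite_measure set Y -> \bar R}).
Local Open Scope ereal_scope.

Lemma integral_indic_xsection (V : set (X * Y)) x : measurable V ->
  \int[m]_y (\1_V (x, y))%:E = m (xsection V x).
Proof.
move=> mV; rewrite -[xsection V x]setIT -integral_indic; last 2 first.
- exact: measurableT.
- exact: measurable_xsection.
by apply: eq_integral => y _; rewrite !indicE mem_xsection.
Qed.

Lemma integral_indic_ysection (V : set (X * Y)) y : measurable V ->
  \int[mu]_x (\1_V (x, y))%:E = mu (ysection V y).
Proof.
move=> mV; rewrite -[ysection V y]setIT -integral_indic; last 2 first.
- exact: measurableT.
- exact: measurable_ysection.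
by apply: eq_integral => x _; rewrite !indicE mem_ysection.
Qed.

Lemma integral_sections (V : set (X * Y)) : measurable V ->
  \int[m]_y mu (ysection V y) = \int[mu]_x m (xsection V x).
Proof.
move=> mV; pose f (z : X * Y) : \bar R := (\1_V z)%:E.
have mf : measurable_fun [set: X * Y] f by exact: measurableT_comp.
have f0 z : 0 <= f z by rewrite lee_fin.
transitivity (\int[m]_y \int[mu]_x f (x, y)).
  by apply: eq_integral => y _; rewrite integral_indic_ysection.
rewrite -fubini_tonelli//.
by apply: eq_integral => x _; rewrite integral_indic_xsection.
Qed.

(** Let [G y] be the measure of the section at [y].  The integral of [G] is at
    least [a] and that of [G ^ 2] is at most [Q].  For each [M > 0], [G] is at
    most [M] on its support plus [G ^ 2 / M]; with [M = 2 Q / a] the last term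
    contributes at most [a / 2] to the integral. *)
Lemma second_moment (W : set (X * Y)) (a Q : R) : measurable W ->
  (0 < a)%R -> (0 < Q)%R ->
  (forall x, a%:E <= m (xsection W x)) ->
  (forall x, \int[mu]_x' m (xsection W x `&` xsection W x') <= Q%:E) ->
  (a ^+ 2 / (4 * Q))%:E <= m [set y | 0 < mu (ysection W y)].
Proof.
move=> mW a0 Q0 aW WQ.
pose G y := mu (ysection W y); pose S := [set y | 0 < G y].
have mG : measurable_fun setT G by exact: measurable_fun_ysection.
have G0 y : 0 <= G y by exact: measure_ge0.
have Gfin y : G y \is a fin_num by exact: fin_num_measure (measurable_ysection _ mW).
have mS : measurable S.
  by rewrite -[S]setTI; exact: emeasurable_fun_o_infty.
have [->|Sfin] := eqVneq (m S) +oo; first by rewrite leey.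
have mSfin : m S \is a fin_num by rewrite ge0_fin_numE ?ltey// measure_ge0.
pose M := (2 * Q / a)%R.
have M0 : (0 < M)%R by rewrite divr_gt0// mulr_gt0.
have low : a%:E <= \int[m]_y G y.
  rewrite integral_sections//.
  apply: (@le_trans _ _ (\int[mu]_x (cst a%:E x))).
    by rewrite integral_cst//= probability_setT mule1.
  apply: ge0_le_integral => //=; first by move=> *; rewrite lee_fin ltW.
  exact: measurable_fun_xsection.
have G2 : \int[m]_y (G y * G y) <= Q%:E.
  pose f (z : X * Y) := (\1_W z)%:E * G z.2.
  have mf : measurable_fun [set: X * Y] f.
    apply: emeasurable_funM; first exact: measurableT_comp.
    exact: measurableT_comp.
  have f0 z : 0 <= f z by rewrite mule_ge0// lee_fin.
  have -> : \int[m]_y (G y * G y) = \int[m]_y \int[mu]_x f (x, y).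
    apply: eq_integral => y _; rewrite /f/=.
    rewrite ge0_integralZr//=; last first.
      apply: measurableT_comp => //; apply: measurableT_comp => //.
    by rewrite integral_indic_ysection.
  rewrite -fubini_tonelli//.
  apply: (@le_trans _ _ (\int[mu]_x (cst Q%:E x))); last first.
    by rewrite integral_cst//= probability_setT mule1.
  apply: ge0_le_integral => //=.
  - by move=> x _; apply: integral_ge0.
  - exact: measurable_fun_fubini_tonelli_F.
  move=> x _; apply: le_trans (WQ x).
  (* the section of [V] at [y] has measure [1_W (x, y) * G y] *)
  pose V := W `&` (setT `*` xsection W x).
  have mWx : measurable (xsection W x) by exact: measurable_xsection.
  have mV : measurable V by apply: measurableI => //; exact: measurableX.
  rewrite [leRHS](_ : _ = \int[mu]_x' m (xsection V x')); last first.
    apply: eq_integral => x' _; congr (m _).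
    by rewrite setIC xsectionI in_xsectionX// inE.
  rewrite -integral_sections// le_eqVlt; apply/orP; left; apply/eqP.
  apply: eq_integral => y _; rewrite /f/= /G indicE ysectionI.
  have [yW|yW] := boolP ((x, y) \in W).
    by rewrite mul1e in_ysectionX ?setIT// mem_xsection.
  by rewrite mul0e notin_ysectionX ?setI0 ?measure0// mem_xsection.
have Gle y : G y <= M%:E * (\1_S y)%:E + M^-1%:E * (G y * G y).
  have := G0 y; rewrite -(fineK (Gfin y)) lee_fin -!EFinM -EFinD lee_fin => g0.
  have [/eqP-> |gn0] := boolP (fine (G y) == 0%R).
    by rewrite !mulr0 addr0 mulr_ge0// ltW.
  have Sy : S y by rewrite /S/= lt0e G0 andbT -(fineK (Gfin y)) eqe.
  rewrite indicE mem_set// mulr1.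
  have [gM|Mg] := leP (fine (G y)) M.
    by rewrite (le_trans gM)// lerDl !mulr_ge0 ?invr_ge0// ltW.
  rewrite (@le_trans _ _ (M^-1 * (fine (G y) * fine (G y)))%R)//.
    by rewrite mulrA ler_peMl// mulrC ler_pdivlMr// mul1r ltW.
  by rewrite lerDr ltW.
have : a%:E <= M%:E * m S + M^-1%:E * Q%:E.
  apply: le_trans low _.
  have mGG : measurable_fun setT (fun y => G y * G y) by exact: emeasurable_funM.
  have m1 : measurable_fun setT (fun y => (\1_S y)%:E : \bar R).
    exact: measurableT_comp.
  have GG0 y : 0 <= G y * G y by rewrite mule_ge0.
  apply: (@le_trans _ _ (\int[m]_y (M%:E * (\1_S y)%:E + M^-1%:E * (G y * G y)))).
    apply: ge0_le_integral => //=.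
    by apply: emeasurable_funD; exact: measurable_funeM.
  rewrite ge0_integralD//=; last 4 first.
  - by move=> y _; rewrite mule_ge0// lee_fin// ltW.
  - exact: measurable_funeM.
  - by move=> y _; rewrite mule_ge0// lee_fin invr_ge0 ltW.
  - exact: measurable_funeM.
  rewrite ge0_integralZl_EFin//= ?(ltW M0)//.
  rewrite ge0_integralZl_EFin//= ?invr_ge0 ?(ltW M0)//.
  rewrite integral_indic// setIT; apply: leeD2l; apply: lee_wpmul2l => //.
  by rewrite lee_fin invr_ge0 ltW.
rewrite -(fineK mSfin) -!EFinM -EFinD !lee_fin.
have -> : (M^-1 * Q = a / 2)%R.
  by rewrite /M; field; rewrite ?gt_eqF.
move=> aM; have -> : (a ^+ 2 / (4 * Q) = a / 2 / M)%R.
  by rewrite /M; field; rewrite ?gt_eqF.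
by rewrite ler_pdivrMr// mulrC; lra.
Qed.

End SecondMoment.

(** * Area and measurability in the plane *)

(** Planar Lebesgue measure, given a name to which its sigma-finiteness can be
    attached. *)
Definition area {R : realType} : set (borel_plane R) -> \bar R :=
  (@lebesgue_measure R \x @lebesgue_measure R)%E.

HB.instance Definition _ (R : realType) := Measure.on (@area R).

Lemma area_sigma_finite (R : realType) : sigma_finite setT (@area R).
Proof.
pose I n : set R := `](- n%:R), n%:R]%classic.
exists (fun n => I n `*` I n); last first.
  move=> n; have mI : measurable (I n) by exact: measurable_itv.
  split; first exact: measurableX.
  have lI : lebesgue_measure (I n) \is a fin_num.
    by rewrite /I lebesgue_measure_itv/=; case: ifP.
  by rewrite /area product_measure1E// lte_mul_pinfty ?measure_ge0// ltey_eq lI.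
apply/seteqP; split => // -[x y] _.
have T z : exists n, I n z.
  by have : [set: R] z by []; rewrite -(bigcup_itvT false false) => -[n _ nz];
    exists n.
have [[m mx] [n ny]] := (T x, T y).
have mono i j z : (i <= j)%N -> I i z -> I j z.
  rewrite -(ler_nat R) /I/= !in_itv/=; lra.
exists (maxn m n) => //; split => /=.
  exact: mono (leq_maxl _ _) mx.
exact: mono (leq_maxr _ _) ny.
Qed.

HB.instance Definition _ (R : realType) :=
  Measure_isSigmaFinite.Build _ _ _ (@area R) (@area_sigma_finite R).

Section PlaneMeasurability.
Context {R : realType}.
Local Notation lam := (@lebesgue_measure R).

(** The open squares with rational centre and radius [1 / n] form a countable
    base of the topology. *)
Lemma open_plane_measurable (U : set (R * R)) :
  open U -> measurable (U : set (borel_plane R)).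
Proof.
move=> oU.
pose box (w : rat * rat * nat) : set (borel_plane R) :=
  ball (ratr w.1.1 : R) (w.2.+1%:R^-1) `*` ball (ratr w.1.2 : R) (w.2.+1%:R^-1).
have -> : U = \bigcup_w (if `[< box w `<=` U >] then box w else set0).
  apply/seteqP; split => [x Ux|x [w _]]; last first.
    by case: ifPn => // /asboolP; apply.
  have /nbhs_ballP[e /= e0 eU] : nbhs x U by exact: open_nbhs_nbhs.
  have e20 : 0 < e / 2 by rewrite divr_gt0.
  have [n ne] : exists n, n.+1%:R^-1 < e / 2.
    have [n _ ne] := near_infty_natSinv_lt (PosNum e20).
    by exists n; exact: (ne n (leqnn n)).
  have n0 : 0 < n.+1%:R^-1 :> R by rewrite invr_gt0 ltr0n.
  set eta := n.+1%:R^-1 in ne n0.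
  have ratnear (t : R) : exists r : rat, ball (ratr r : R) eta t.
    have [|r] := @rat_in_itvoo R (t - eta) (t + eta); first by lra.
    by rewrite in_itv/= => rt; exists r; rewrite /ball/= ltr_norml; lra.
  have [[r1 xr1] [r2 xr2]] := (ratnear x.1, ratnear x.2).
  exists (r1, r2, n) => //; case: ifPn => [_|/asboolP[]]; first by split.
  rewrite /box/= -/eta => y [/= yr1 yr2]; apply: eU; split=> /=.
  - move: xr1 yr1; rewrite /ball/= !ltr_norml; lra.
  - move: xr2 yr2; rewrite /ball/= !ltr_norml; lra.
apply: countable_bigcupT_measurable; first exact: countableP.
move=> w; case: ifPn => // _; apply: measurableX; exact: measurable_ball.
Qed.

Lemma compact_plane_measurable (E : set (R * R)) :
  compact E -> measurable (E : set (borel_plane R)).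
Proof.
move=> cE; rewrite -[E]setCK; apply: measurableC; apply: open_plane_measurable.
by rewrite openC; apply: compact_closed => //; exact: norm_hausdorff.
Qed.

Lemma eucl_ball_measurable (x : R * R) r :
  measurable (eucl_ball x r : set (borel_plane R)).
Proof.
have mcoord (f : borel_plane R -> R) c : measurable_fun setT f ->
    measurable_fun setT (fun y => (c - f y) ^+ 2).
  by move=> mf; apply: measurable_funX; apply: measurable_funB.
have md : measurable_fun setT (fun y : borel_plane R => eucl_dist x y).
  apply: (@measurableT_comp _ _ _ _ _ _ (@Num.sqrt R)).
    by apply: continuous_measurable_fun; exact: sqrt_continuous.
  by apply: measurable_funD; exact: mcoord.
rewrite -[eucl_ball x r]setTI.
have -> : eucl_ball x r = (fun y => eucl_dist x y) @^-1` `]-oo, r[%classic.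
  by apply/seteqP; split => y /=; rewrite in_itv.
by apply: md => //; exact: measurable_itv.
Qed.

Definition strip (J : set R) (phi : R -> R) (delta : R) : set (borel_plane R) :=
  [set y | J y.1 /\ `|y.2 - phi y.1| <= delta].

Lemma measurable_strip J phi delta : measurable J -> measurable_fun setT phi ->
  measurable (strip J phi delta).
Proof.
move=> mJ mphi.
have -> : strip J phi delta = (setT `&` fst @^-1` J) `&`
    (setT `&` (fun y : borel_plane R => y.2 - phi y.1) @^-1`
      `[- delta, delta]%classic).
  by apply/seteqP; split => y; rewrite /strip/= in_itv/= ler_norml; tauto.
apply: measurableI; first exact: measurable_fst.
have : measurable_fun setT (fun y : borel_plane R => y.2 - phi y.1).
  apply: measurable_funB; first exact: measurable_snd.
  by apply: measurableT_comp => //; exact: measurable_fst.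
by apply => //; exact: measurable_itv.
Qed.

Lemma strip_area (J : set R) phi delta : measurable J -> measurable_fun setT phi ->
  0 <= delta ->
  area (strip J phi delta) =((2 * delta)%:E * lam J)%E.
Proof.
move=> mJ mphi d0; rewrite /area /product_measure1.
rewrite (_ : _ \o _ = fun a => ((2 * delta)%:E * (\1_J a)%:E)%E); last first.
  apply/funext => a /=; rewrite indicE; have [Ja|Ja] := boolP (a \in J).
  - rewrite mule1 (_ : xsection _ _ = `[phi a - delta, phi a + delta]%classic).
      rewrite lebesgue_measure_itv/= lte_fin; case: ifPn => [_|].
        by rewrite -EFinD; congr (_%:E); lra.
      by rewrite -leNgt => ?; congr (_%:E); lra.
    apply/seteqP; split => [z /xsectionP[/= _]|z /=].
      by rewrite ler_norml in_itv/=; lra.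
    rewrite in_itv/= => zI; apply/xsectionP; split; first by rewrite -inE.
    by rewrite /= ler_norml; lra.
  - rewrite mule0 (_ : xsection _ _ = set0) ?measure0//.
    by apply/seteqP; split => z // /xsectionP[/=]; rewrite -inE (negbTE Ja).
rewrite ge0_integralZl_EFin//; last 2 first.
- exact: measurableT_comp.
- by rewrite mulr_ge0.
by rewrite integral_indic// setIT.
Qed.

End PlaneMeasurability.

(** * Incidences between points and translates of a graph *)

Section Overlap.
Context {R : realType}.
Local Notation lam := (@lebesgue_measure R).
Local Notation plane := (borel_plane R).

(** For [T] the projection of a piece of the graph of [g], a pair [(x, y)] is
    here when [y] is vertically [delta]-close to the translate of that piece by
    [x]. *)
Definition incidence (T : set R) (g : R -> R) (delta : R) : set (plane * plane) :=
  [set z | T (z.2.1 - z.1.1) /\ `|z.2.2 - (z.1.2 + g (z.2.1 - z.1.1))| <= delta].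

Lemma xsection_incidence T g delta (x : plane) :
  xsection (incidence T g delta) x =
  strip [set t | T (t - x.1)] (fun t => x.2 + g (t - x.1)) delta.
Proof. by rewrite xsectionE. Qed.

Lemma measurable_incidence T g delta : measurable T -> continuous g ->
  measurable (incidence T g delta).
Proof.
move=> mT cg.
have mc11 : measurable_fun [set: plane * plane] (fun z => z.1.1).
  by apply: measurableT_comp; [exact: measurable_fst|exact: measurable_fst].
have mc12 : measurable_fun [set: plane * plane] (fun z => z.1.2).
  by apply: measurableT_comp; [exact: measurable_snd|exact: measurable_fst].
have mc21 : measurable_fun [set: plane * plane] (fun z => z.2.1).
  by apply: measurableT_comp; [exact: measurable_fst|exact: measurable_snd].
have mc22 : measurable_fun [set: plane * plane] (fun z => z.2.2).
  by apply: measurableT_comp; [exact: measurable_snd|exact: measurable_snd].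
have mdiff : measurable_fun [set: plane * plane] (fun z => z.2.1 - z.1.1).
  exact: (@measurable_funB _ (plane * plane)%type R setT).
have mheight : measurable_fun [set: plane * plane]
    (fun z => z.2.2 - (z.1.2 + g (z.2.1 - z.1.1))).
  apply: (@measurable_funB _ (plane * plane)%type R setT) => //.
  apply: (@measurable_funD _ (plane * plane)%type R setT) => //.
  apply: measurableT_comp mdiff; exact: continuous_measurable_fun.
have -> : incidence T g delta = (setT `&` (fun z => z.2.1 - z.1.1) @^-1` T) `&`
    (setT `&` (fun z => z.2.2 - (z.1.2 + g (z.2.1 - z.1.1))) @^-1`
      `[- delta, delta]%classic).
  by apply/seteqP; split => z; rewrite /incidence/= in_itv/= ler_norml; tauto.
apply: measurableI; first exact: mdiff.
by apply: mheight => //; exact: measurable_itv.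
Qed.

Lemma incidence_area T g delta x : measurable T -> continuous g -> 0 <= delta ->
  area (xsection (incidence T g delta) x) = ((2 * delta)%:E * lam T)%E.
Proof.
move=> mT cg d0; rewrite xsection_incidence.
have msh : measurable_fun setT (fun t : R => t - x.1).
  by apply: measurable_funB => //; exact: measurable_id.
rewrite strip_area//; last 2 first.
- by rewrite -[X in measurable X]setTI; exact: msh.
- apply: measurable_funD => //; apply: measurableT_comp msh.
  exact: continuous_measurable_fun.
by rewrite lebesgue_shift.
Qed.

(** At a point incident to both [x] and [x'], the two translated graphs are
    [2 delta]-close.  As [g] is Lipschitz, [|x - x'| >= 4 delta] then forces the
    horizontal gap [|x.1 - x'.1|] to be comparable with [|x - x'|], and by
    separation of the translates such points have their abscissae in an interval
    of radius [rho], of order [delta / |x - x'|].  What remains is a strip of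
    height [2 delta] over that interval. *)
Lemma incidence_overlap (p q c0 L : R) (T : set R) (g : R -> R) (delta : R)
    (x x' : plane) :
  0 < c0 -> 0 <= L -> 0 < delta ->
  measurable T -> (forall t, T t -> t \in `[p, q]) -> continuous g ->
  (forall u v, u \in `[p, q] -> v \in `[p, q] -> `|g u - g v| <= L * `|u - v|) ->
  (forall a b t s, t - a \in `[p, q] -> t - b \in `[p, q] ->
      s - a \in `[p, q] -> s - b \in `[p, q] ->
    c0 * `|a - b| * `|t - s| <=
      `|(g (t - a) - g (t - b)) - (g (s - a) - g (s - b))|) ->
  4 * delta <= eucl_dist x x' ->
  (area (xsection (incidence T g delta) x `&`
                 xsection (incidence T g delta) x') <=
   (32 * (1 + L) / c0 * delta ^+ 2 / eucl_dist x x')%:E)%E.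
Proof.
move=> c00 L0 d0 mT Tpq cg lipg sepg dxx'.
set W := incidence T g delta; set d := eucl_dist x x' in dxx' *.
have dpos : 0 < d by apply: lt_le_trans dxx'; rewrite mulr_gt0.
have [->|] := eqVneq (xsection W x `&` xsection W x') set0.
  rewrite measure0 lee_fin divr_ge0 ?ltW// mulr_gt0 ?exprn_gt0// divr_gt0//.
  by rewrite mulr_gt0// ltr_wpDr.
move=> /set0P[y0 [/xsectionP[/= T1 b1] /xsectionP[/= T2 b2]]].
have d1 : d / 2 <= (1 + L) * `|x.1 - x'.1|.
  have lg := lipg _ _ (Tpq _ T1) (Tpq _ T2).
  rewrite (_ : _ - _ - (_ - _) = - (x.1 - x'.1)) in lg; last by lra.
  rewrite normrN in lg.
  have := eucl_dist_le_l1 x x'; rewrite -/d.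
  have : `|x.2 - x'.2| <= 2 * delta + L * `|x.1 - x'.1|.
    move: b1 b2 lg; rewrite !ler_norml; lra.
  lra.
set rho := 8 * (1 + L) * delta / (c0 * d).
have near1 y : xsection W x y -> xsection W x' y -> `|y.1 - y0.1| <= rho.
  move=> /xsectionP[/= S1 e1] /xsectionP[/= S2 e2].
  have := sepg _ _ _ _ (Tpq _ S1) (Tpq _ S2) (Tpq _ T1) (Tpq _ T2).
  set H := `|_ - _ - (_ - _)| => sep.
  have H4 : H <= 4 * delta.
    by rewrite /H; move: b1 b2 e1 e2; rewrite !ler_norml; lra.
  rewrite /rho ler_pdivlMr ?mulr_gt0//.
  have : c0 * (d / 2) * `|y.1 - y0.1| <= (1 + L) * (4 * delta).
    apply: (@le_trans _ _ ((1 + L) * (c0 * `|x.1 - x'.1| * `|y.1 - y0.1|))).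
      by rewrite [leRHS]mulrA ler_wpM2r// (mulrCA (1 + L)) ler_pM2l.
    by rewrite ler_wpM2l ?addr_ge0// (le_trans sep).
  lra.
have -> : 32 * (1 + L) / c0 * delta ^+ 2 / d = 2 * delta * (2 * rho).
  by rewrite /rho; field; rewrite !gt_eqF.
have rho0 : 0 <= rho.
  by rewrite divr_ge0 ?mulr_ge0 ?addr_ge0// ltW// mulr_gt0.
have mphi : measurable_fun setT (fun t : R => x.2 + g (t - x.1)).
  apply: measurable_funD => //; apply: measurableT_comp.
    exact: continuous_measurable_fun.
  by apply: measurable_funB => //; exact: measurable_id.
pose I : set R := `[y0.1 - rho, y0.1 + rho]%classic.
have mI : measurable I by exact: measurable_itv.
have mW : measurable W by exact: measurable_incidence.
apply: (@le_trans _ _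
    (area (strip I (fun t => x.2 + g (t - x.1)) delta))).
  apply: le_measure; rewrite ?inE.
  - by apply: measurableI; exact: measurable_xsection.
  - exact: measurable_strip.
  move=> y [yx yx']; have := near1 y yx yx'; rewrite ler_norml => nr.
  split; first by rewrite /I/= in_itv/=; lra.
  by have /xsectionP[] := yx.
rewrite strip_area ?(ltW d0)//.
have lamI : lam I = (2 * rho)%:E.
  rewrite lebesgue_measure_itv/= lte_fin; case: ifPn => [_|].
    by rewrite -EFinD; congr (_%:E); lra.
  by rewrite -leNgt => ?; congr (_%:E); lra.
by rewrite lamI -EFinM.
Qed.

End Overlap.

(** * The dyadic energy of an upper regular measure *)

Section DyadicEnergy.
Context {R : realType}.
Implicit Types (d v K delta C s : R).

(** A dyadic majorant of [1 / |x - y|] truncated at the scale [2 ^ - N], written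
    with indicators of balls so that a measure integrates it through its values
    on balls. *)
Definition dyadic_kernel (N : nat) (x y : R * R) : R :=
  1 + \sum_(k < N.+1) 2 ^+ k.+1 * \1_(eucl_ball x (2 ^- k)) y.

Lemma inv_le_dyadic_kernel N (x y : R * R) : 2 ^- N.+1 <= eucl_dist x y ->
  (eucl_dist x y)^-1 <= dyadic_kernel N x y.
Proof.
set d := eucl_dist x y; rewrite /dyadic_kernel.
have term0 k : 0 <= 2 ^+ k.+1 * \1_(eucl_ball x (2 ^- k)) y :> R.
  by rewrite mulr_ge0// exprn_ge0.
suff Hj j : 2 ^- j <= d ->
    d^-1 <= 1 + \sum_(k < j) 2 ^+ k.+1 * \1_(eucl_ball x (2 ^- k)) y :> R.
  exact: Hj.
elim: j => [|j IH] dj.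
  rewrite big_ord0 addr0 invf_le1; last first.
    by apply: lt_le_trans dj; rewrite invr_gt0 expr0.
  by move: dj; rewrite expr0 invr1.
have d0 : 0 < d by apply: lt_le_trans dj; rewrite invr_gt0 exprn_gt0.
rewrite big_ord_recr/= addrA.
have [jd|dlt] := leP (2 ^- j) d.
  by apply: le_trans (IH jd) _; rewrite lerDl.
have -> : \1_(eucl_ball x (2 ^- j)) y = 1 :> R by rewrite indicE mem_set.
rewrite mulr1 (@le_trans _ _ (2 ^+ j.+1))//.
  by rewrite -[leRHS]invrK lef_pV2// posrE ?invr_gt0 exprn_gt0.
by rewrite lerDr addr_ge0// sumr_ge0.
Qed.

(** Above the scale [2 ^ - N.+1] the kernel exceeds the inverse distance; below
    it, its last term alone exceeds [2 ^ N >= 1 / delta]. *)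
Lemma le_dyadic_kernel N (x y : R * R) K delta v : 0 < K -> 0 < delta ->
  1 <= delta * 2 ^+ N -> v <= K * delta ->
  (0 < eucl_dist x y -> v <= K * delta ^+ 2 / eucl_dist x y) ->
  v <= K * delta ^+ 2 * dyadic_kernel N x y.
Proof.
move=> K0 d0 N1 vK vd.
have Kd0 : 0 < K * delta ^+ 2 by rewrite mulr_gt0// exprn_gt0.
have [Nd|dN] := leP (2 ^- N.+1) (eucl_dist x y).
  have dpos : 0 < eucl_dist x y.
    by apply: lt_le_trans Nd; rewrite invr_gt0 exprn_gt0.
  apply: le_trans (vd dpos) _; rewrite ler_pM2l//.
  exact: inv_le_dyadic_kernel.
apply: le_trans vK _;
rewrite [leRHS](_ : _ = K * delta * (delta * dyadic_kernel N x y)); last first.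
  by rewrite expr2 !mulrA.
rewrite ler_peMr ?(ltW (mulr_gt0 K0 d0))//.
rewrite (le_trans N1)// ler_pM2l// /dyadic_kernel big_ord_recr/= addrA.
have dN' : eucl_dist x y < 2 ^- N.
  apply: lt_trans dN _; rewrite ltf_pV2 ?posrE ?exprn_gt0//.
  by rewrite ltr_eXn2l// ltr1n.
have -> : \1_(eucl_ball x (2 ^- N)) y = 1 :> R by rewrite indicE mem_set.
rewrite mulr1 (@le_trans _ _ (2 ^+ N.+1))//.
  by rewrite ler_eXn2l// ltr1n.
by rewrite lerDr addr_ge0// sumr_ge0.
Qed.

Lemma measurable_dyadic_kernel N x :
  measurable_fun setT (fun y : borel_plane R => dyadic_kernel N x y).
Proof.
apply: measurable_funD => //; apply: measurable_sum => k.
apply: measurable_funM => //.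
by apply: measurable_indic; exact: eucl_ball_measurable.
Qed.

(** The ball of radius [2 ^ - k] contributes [2 ^ (k + 1) * C * 2 ^ (- k s)]. *)
Lemma integral_dyadic_kernel (mu : probability (borel_plane R) R) C s N x :
  upper_regular mu C s ->
  (\int[mu]_y (dyadic_kernel N x y)%:E <=
    (1 + 2 * C * \sum_(k < N.+1) (2 `^ (1 - s)) ^+ k)%:E)%E.
Proof.
move=> muC.
have mball k : measurable (eucl_ball x (2 ^- k) : set (borel_plane R)).
  exact: eucl_ball_measurable.
have mind k : measurable_fun setT (fun y : borel_plane R =>
    (2 ^+ k.+1 * \1_(eucl_ball x (2 ^- k)) y : R)%:E).
  apply/measurable_EFinP; apply: measurable_funM => //.
under eq_integral do rewrite /dyadic_kernel EFinD -sumEFin.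
rewrite ge0_integralD//=; last 2 first.
- by move=> y _; apply: sume_ge0 => k _; rewrite lee_fin mulr_ge0// exprn_ge0.
- exact: emeasurable_sum.
rewrite integral_cst//= probability_setT mule1 EFinD.
apply: leeD => //.
rewrite ge0_integral_sum//.
rewrite mulr_sumr -sumEFin; apply: lee_sum => k _.
under eq_integral do rewrite EFinM.
rewrite ge0_integralZl_EFin//; last by apply/measurable_EFinP.
rewrite integral_indic// setIT.
have mub := muC x (2 ^- k).
apply: (@le_trans _ _ ((2 ^+ k.+1)%:E * (C * (2 ^- k) `^ s)%:E)%E).
  rewrite lee_wpmul2l// ?lee_fin ?exprn_ge0// mub//.
  by rewrite invf_le1 ?exprn_gt0// exprn_ege1// ler1n.
rewrite -EFinM lee_fin le_eqVlt; apply/orP; left; apply/eqP.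
rewrite exprS -!mulrA; congr (_ * _); rewrite mulrCA; congr (_ * _).
rewrite -powR_invn// -!powR_mulrn ?powR_ge0// -!powRrM -powRD.
  by congr (_ `^ _); rewrite mulNr mulrBl mul1r [_ * s]mulrC.
by rewrite pnatr_eq0 implybT.
Qed.

Lemma dyadic_scale delta : 0 < delta -> delta <= 1 ->
  exists N, 1 <= delta * 2 ^+ N <= 2.
Proof.
move=> d0 d1.
have exN : exists N, 1 <= delta * 2 ^+ N.
  exists (Num.truncn delta^-1).+1; rewrite mulrC -ler_pdivrMr// div1r ltW//.
  rewrite (lt_le_trans (truncnS_gt _))// -natrX ler_nat ltnW//.
  exact: ltn_expl.
exists (ex_minn exN); case: ex_minnP => -[|N] N1 Nmin.
  by rewrite N1/= expr0 mulr1 (le_trans d1)// ler1n.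
rewrite N1/=; have := Nmin N; rewrite ltnn; case: leP => [_ /(_ isT)//|+ _].
by rewrite exprS mulrCA; lra.
Qed.

(** The geometric sum, of ratio [r = 2 ^ (1 - s) > 1], is dominated by its last
    term, and [r ^ N = (2 ^ N) ^ (1 - s) <= (2 / delta) ^ (1 - s)]. *)
Lemma dyadic_energy_subcritical C s : 0 <= C -> s < 1 ->
  exists2 B, 0 < B & forall delta N, 0 < delta -> delta <= 1 ->
    delta * 2 ^+ N <= 2 ->
    1 + 2 * C * \sum_(k < N.+1) (2 `^ (1 - s)) ^+ k <= B / delta `^ (1 - s).
Proof.
move=> C0 s1; set r := 2 `^ (1 - s).
have t0 : 0 < 1 - s by rewrite subr_gt0.
have r1 : 1 < r.
  have : 1 `^ (1 - s) < r by rewrite gt0_ltr_powR ?nnegrE// ltr1n.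
  by rewrite powR1.
have r10 : 0 < r - 1 by rewrite subr_gt0.
have r0 : 0 < r by apply: lt_trans r1.
(* one factor [r] comes from the exponent [N.+1], the other from [2 / delta] *)
exists (1 + 2 * C * (r ^+ 2 / (r - 1))).
  by rewrite ltr_wpDr// !mulr_ge0 ?invr_ge0 ?exprn_ge0 ?(ltW r10) ?(ltW r0).
move=> delta N d0 d1 dN; have dt0 : 0 < delta `^ (1 - s) by exact: powR_gt0.
have rN : r ^+ N.+1 <= r ^+ 2 / delta `^ (1 - s).
  rewrite exprS expr2 -mulrA ler_pM2l// ler_pdivlMr//.
  rewrite -powR_mulrn ?(ltW r0)// powRAC powR_mulrn// -powRM ?exprn_ge0 ?(ltW d0)//.
  apply: ge0_ler_powR; rewrite ?nnegrE ?mulr_ge0 ?exprn_ge0 ?(ltW d0)// ?(ltW t0)//.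
  by rewrite mulrC.
have geom : \sum_(k < N.+1) r ^+ k <= r ^+ 2 / (r - 1) / delta `^ (1 - s).
  rewrite mulrAC ler_pdivlMr// mulrC -subrX1.
  by rewrite (le_trans _ rN)// lerBlDr lerDl.
rewrite [leRHS]mulrDl mul1r lerD//.
  rewrite invf_ge1//; have : delta `^ (1 - s) <= 1 `^ (1 - s).
    by apply: ge0_ler_powR; rewrite ?nnegrE ?(ltW t0) ?(ltW d0).
  by rewrite powR1.
by rewrite -[leRHS]mulrA ler_wpM2l// mulr_ge0.
Qed.

(** All [N + 1] terms of the sum are equal to [1], and [N] is at most
    [1 + log (1 / delta) / log 2]. *)
Lemma dyadic_energy_critical C : 0 <= C ->
  exists2 B, 0 < B & forall delta N, 0 < delta -> delta < 2^-1 ->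
    delta * 2 ^+ N <= 2 ->
    1 + 2 * C * \sum_(k < N.+1) (2 `^ (1 - 1)) ^+ k <= B * ln (1 / delta).
Proof.
move=> C0; have ln20 : 0 < ln 2 :> R by rewrite ln_gt0// ltr1n.
exists ((1 + 6 * C) / ln 2); first by rewrite divr_gt0// ltr_wpDr// mulr_ge0.
move=> delta N d0 d2 dN; set l := ln (1 / delta).
have ll : ln 2 <= l.
  rewrite ler_ln ?posrE ?divr_gt0// div1r -[leLHS]invrK lef_pV2 ?posrE ?invr_gt0//.
  exact: ltW.
have Nl : N%:R * ln 2 <= ln 2 + l.
  rewrite mulr_natl -lnXn// -lnM ?posrE ?divr_gt0//.
  rewrite ler_ln ?posrE ?mulr_gt0 ?exprn_gt0 ?divr_gt0 ?invr_gt0//.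
  by rewrite mulrA mulr1 ler_pdivlMr// mulrC.
under eq_bigr do rewrite subrr powRr0 expr1n.
rewrite sumr_const card_ord [leRHS]mulrAC ler_pdivlMr// -natr1.
rewrite (_ : _ * ln 2 = ln 2 + 2 * C * (N%:R * ln 2 + ln 2)); last by ring.
rewrite (_ : (1 + 6 * C) * l = l + 2 * C * (3 * l)); last by ring.
by rewrite lerD// ler_wpM2l ?mulr_ge0//; lra.
Qed.

Lemma dyadic_energy_bound C s : 0 <= C -> s <= 1 ->
  exists2 B, 0 < B & forall delta, 0 < delta -> delta < 2^-1 ->
    exists N, [/\ 1 <= delta * 2 ^+ N,
     s < 1 -> 1 + 2 * C * \sum_(k < N.+1) (2 `^ (1 - s)) ^+ k
                <= B / delta `^ (1 - s) &
     s = 1 -> 1 + 2 * C * \sum_(k < N.+1) (2 `^ (1 - s)) ^+ k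
                <= B * ln (1 / delta)].
Proof.
move=> C0; rewrite le_eqVlt => /predU1P[->|s1].
  have [B B0 HB] := dyadic_energy_critical C0.
  exists B => // delta d0 d2; have [|N /andP[N1 N2]] := dyadic_scale d0; first by lra.
  by exists N; split => // [|_]; [rewrite ltxx|exact: HB].
have [B B0 HB] := dyadic_energy_subcritical C0 s1.
exists B => // delta d0 d2; have d1 : delta <= 1 by lra.
have [N /andP[N1 N2]] := dyadic_scale d0 d1.
by exists N; split => // [_|s1']; [exact: HB|rewrite s1' ltxx in s1].
Qed.

End DyadicEnergy.

(** * The lower bound for the Favard length *)

Section Assembly.
Context {R : realType}.
Local Notation lam := (@lebesgue_measure R).
Local Notation plane := (borel_plane R).

(** The integral of a nonnegative function is a supremum over the simple
    functions below it, hence is monotone without measurability.  This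
    spares the study of the length of the projections of a thickened set as a
    function of [alpha]. *)
Lemma le_integral_nonmeasurable d (X : measurableType d)
    (mu : {measure set X -> \bar R}) (f h : X -> \bar R) :
  (forall x, 0 <= f x)%E -> (forall x, f x <= h x)%E ->
  (\int[mu]_x f x <= \int[mu]_x h x)%E.
Proof.
move=> f0 fh; have h0 x : (0 <= h x)%E by apply: le_trans (f0 x) (fh x).
rewrite !ge0_integralTE//; apply: ge_ereal_sup => _ [k kf <-].
by apply: ereal_sup_ubound; exists k => //= x; apply: le_trans (kf x) (fh x).
Qed.

Lemma area_le_Fav (a b : R) (gamma : R -> R) (E : set (R * R)) (S : set plane) :
  (forall y, S y -> curve_proj a b gamma E y.1 y.2) ->
  (area S <= Fav a b gamma E)%E.
Proof.
move=> SE; apply: le_integral_nonmeasurable => [x|x]; first exact: measure_ge0.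
by apply: le_mu_ext => z /xsectionP /SE.
Qed.

(** Since [mu] is carried by [E], the section contains a point [x] of [E].
    Moving [x] vertically by at most [delta] puts [y] exactly on its
    translate. *)
Lemma incidence_curve_proj (a b delta : R) (gamma g : R -> R) (T : set R)
    (E : set (R * R)) (mu : probability plane R) (y : plane) :
  (forall t, T t -> t \in `[a, b] /\ g t = gamma t) ->
  continuous g -> measurable T ->
  compact E -> supports E mu ->
  (0 < mu (ysection (incidence T g delta) y))%E ->
  curve_proj a b gamma (thicken E delta) y.1 y.2.
Proof.
move=> Tg cg mT cE muE mupos.
have mE : measurable (E : set plane) by exact: compact_plane_measurable.
have mW := @measurable_incidence R T g delta mT cg.
have [x [Ex /ysectionP[/= Tx bx]]] :
    exists x, E x /\ ysection (incidence T g delta) y x.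
  apply: contrapT => nx; move: mupos; rewrite ltNge => /negP; apply.
  have <- : mu (~` E) = 0%E.
    by rewrite probability_setC// muE subee.
  apply: le_measure; rewrite ?inE.
  - exact: measurable_ysection.
  - exact: measurableC.
  - by move=> x Wx Ex; apply: nx; exists x.
have [tab gt] := Tg _ Tx.
exists (x.1, y.2 - gamma (y.1 - x.1)); last by rewrite /= subrK.
split => //=; apply: (@le_trans _ _ (eucl_dist (x.1, y.2 - gamma (y.1 - x.1)) x)%:E).
  by apply: ereal_inf_lbound; exists x.
rewrite lee_fin /eucl_dist/= subrr expr0n/= add0r sqrtr_sqr -gt.
by rewrite (_ : y.2 - _ - _ = y.2 - (x.2 + g (y.1 - x.1)))//; ring.
Qed.

(** The constant [kappa] is chosen before the curve, the set and the measure: it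
    depends only on the piece [A] of the curved graph. *)
Lemma fav_lower_bound (p q c0 : R) (g0 : R -> R) (A : set (R * R)) :
  p < q -> 0 < c0 -> C2_on p q g0 ->
  (forall x, x \in `[p, q] -> c0 <= `|derive_on p q (derive_on p q g0) x|) ->
  compact A -> A `<=` graph_on p q g0 -> (0 < hausdorff1 A)%E ->
  exists2 kappa, 0 < kappa &
    forall a b gamma, A `<=` graph_on a b gamma ->
    forall E (mu : probability plane R) C s, compact E -> supports E mu ->
      upper_regular mu C s -> 0 <= C ->
    forall delta N, 0 < delta -> 1 <= delta * 2 ^+ N ->
    ((kappa / (1 + 2 * C * \sum_(k < N.+1) (2 `^ (1 - s)) ^+ k))%:E
      <= Fav a b gamma (thicken E delta))%E.
Proof.
move=> pq c00 [dg0 dg1 _] curved cA Ag0 HA.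
have [cg gE dg] := derivable_on_extension pq dg0.
have [cg1 g1E dg1'] := derivable_on_extension pq dg1.
set g := g0 \o _ in cg gE dg; set g1 := _ \o _ in cg1 g1E dg1'.
have sub t : t \in `]p, q[ -> t \in `[p, q] by exact: subset_itv_oo_cc.
have dgg1 t : t \in `]p, q[ -> is_derive t 1 g (g1 t).
  by move=> tpq; rewrite g1E ?sub//; exact: dg.
have [L L0 g1L] := continuous_bounded_itv pq cg1.
have lipg := mvt_upper cg dgg1 (fun t tpq => g1L t (sub t tpq)).
have sepg := translates_separate cg cg1 dgg1 dg1' (fun t tpq => curved t (sub t tpq)).
pose T := fst @` A.
have TA t : T t -> t \in `[p, q] /\ A (t, g t).
  move=> [x Ax <-]; have [u /= upq ux] := Ag0 _ Ax.
  by rewrite -ux /=; split => //; rewrite gE// ux.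
have Tpq t : T t -> t \in `[p, q] by move=> /TA[].
have cT : compact T.
  apply: continuous_compact cA; apply: continuous_subspaceT; by move=> x; exact: cvg_fst.
have mT : measurable T by exact: compact_measurable.
have lamTpq : (lam T <= (q - p)%:E)%E.
  apply: (@le_trans _ _ (lam `[p, q]%classic)).
    by apply: le_mu_ext => t /Tpq.
  by rewrite lebesgue_measure_itv/= lte_fin pq.
have lamT0 : (0 < lam T)%E.
  rewrite lt0e measure_ge0 andbT; apply/eqP => T0.
  suff : (hausdorff1 A <= 0)%E by rewrite leNgt HA.
  apply: hausdorff1_lipschitz_null L0 _ T0 => x y Ax Ay.
  have [[u upq <-] [v vpq <-]] := (Ag0 _ Ax, Ag0 _ Ay).
  by rewrite /= -!gE//; exact: lipg.
have lamTfin : lam T \is a fin_num.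
  by rewrite ge0_fin_numE ?measure_ge0// (le_lt_trans lamTpq)// ltry.
pose tau := fine (lam T).
have lamTE : lam T = tau%:E by rewrite fineK.
have tau0 : 0 < tau by rewrite -lte_fin -lamTE.
have tauq : tau <= q - p by rewrite -lee_fin -lamTE.
(* [8 (q - p)] serves when [|x - x'| < 4 delta], where only the trivial bound
   [2 delta |T|] is available; the other term is that of [incidence_overlap] *)
pose K := 8 * (q - p) + 32 * (1 + L) / c0.
have K1 : 8 * (q - p) <= K.
  by rewrite lerDl divr_ge0 ?mulr_ge0 ?addr_ge0 ?(ltW c00).
have K2 : 32 * (1 + L) / c0 <= K by rewrite lerDr mulr_ge0// subr_ge0 ltW.
have K0 : 0 < K by apply: lt_le_trans K1; rewrite mulr_gt0// subr_gt0.
exists (tau ^+ 2 / K); first by rewrite divr_gt0// exprn_gt0.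
move=> a b gamma Agamma E mu C s cE muE muC C0 delta N d0 dN.
set B := 1 + _.
have B0 : 0 < B.
  apply: ltr_wpDr => //; apply: mulr_ge0; first exact: mulr_ge0.
  by apply: sumr_ge0 => k _; rewrite exprn_ge0// powR_ge0.
pose W := incidence T g delta.
have mW : measurable W by exact: measurable_incidence.
apply: (@le_trans _ _ (area [set y | (0 < mu (ysection W y))%E])); last first.
  apply: area_le_Fav => y /=; apply: incidence_curve_proj => //.
  move=> t Tt; have [tpq At] := TA _ Tt; have [u uab [<- ->]] := Agamma _ At.
  by [].
have areaW x : (area (xsection W x) = (2 * delta * tau)%:E)%E.
  by rewrite incidence_area ?(ltW d0)// lamTE -EFinM.
have -> : tau ^+ 2 / K / B = (2 * delta * tau) ^+ 2 / (4 * (K * delta ^+ 2 * B)).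
  by field; rewrite ?gt_eqF.
apply: (second_moment (m := area)) => //.
- by rewrite !mulr_gt0.
- by rewrite !mulr_gt0// exprn_gt0.
- by move=> x; rewrite -(areaW x).
move=> x.
apply: (@le_trans _ _ (\int[mu]_x' ((K * delta ^+ 2)%:E * (dyadic_kernel N x x')%:E))%E).
  apply: le_integral_nonmeasurable => [x'|x']; first exact: measure_ge0.
  pose v := area (xsection W x `&` xsection W x').
  suff : (v <= (K * delta ^+ 2)%:E * (dyadic_kernel N x x')%:E)%E by [].
  have v1 : (v <= (2 * delta * tau)%:E)%E.
    rewrite -(areaW x); apply: le_measure; rewrite ?inE.
    + by apply: measurableI; exact: measurable_xsection.
    + exact: measurable_xsection.
    + by move=> y [].
  have vfin : v \is a fin_num.
    by rewrite ge0_fin_numE ?measure_ge0// (le_lt_trans v1)// ltry.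
  rewrite -(fineK vfin) -EFinM lee_fin.
  have v1' : fine v <= 2 * delta * tau by rewrite -lee_fin fineK.
  apply: le_dyadic_kernel => //.
    by rewrite (le_trans v1')// mulrAC ler_wpM2r ?(ltW d0)//; lra.
  move=> dpos; have [d4|d4] := leP (4 * delta) (eucl_dist x x').
    have := incidence_overlap c00 L0 d0 mT Tpq cg lipg sepg d4.
    rewrite -/W -/v -(fineK vfin) lee_fin => /le_trans; apply.
    by rewrite ler_pM2r ?invr_gt0// ler_pM2r ?exprn_gt0.
  apply: le_trans v1' _; rewrite ler_pdivlMr//.
  apply: (@le_trans _ _ (2 * delta * tau * (4 * delta))).
    by rewrite ler_wpM2l ?(ltW d4)// !mulr_ge0// ltW.
  rewrite (_ : _ * (4 * delta) = 8 * tau * delta ^+ 2); last by ring.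
  by rewrite ler_wpM2r ?exprn_ge0 ?(ltW d0)//; lra.
rewrite ge0_integralZl_EFin//; last 3 first.
- by move=> y _; rewrite lee_fin addr_ge0// sumr_ge0// => k _;
    rewrite mulr_ge0// exprn_ge0.
- by apply/measurable_EFinP; exact: measurable_dyadic_kernel.
- by rewrite mulr_ge0 ?exprn_ge0// ltW.
rewrite [leRHS]EFinM; apply: lee_wpmul2l.
  by rewrite lee_fin mulr_ge0 ?exprn_ge0// ltW.
exact: integral_dyadic_kernel.
Qed.

End Assembly.

Theorem corollary1p4 (R : realType) (A Sigma : set (R * R)) (c0 s Cmu : R)
    (s_gt0 : 0 < s) (s_le1 : s <= 1) :
  exists c delta0 : R,
    [/\ 0 < c, 0 < delta0, delta0 < 2^-1 &
      forall (a b : R) (gamma : R -> R),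
        nondegenerate_graph a b gamma ->
        rectifiable_graph a b gamma ->
        curved_trace (graph_on a b gamma) A Sigma c0 ->
      forall (E : set (R * R)) (mu : probability (borel_plane R) R),
        compact E ->
        supports E mu ->
        upper_regular mu Cmu s ->
      forall delta : R, 0 < delta -> delta < delta0 ->
        (s < 1 ->
          ((c * delta `^ (1 - s))%:E <= Fav a b gamma (thicken E delta))%E)
        /\ (s = 1 ->
          ((c * (ln (1 / delta))^-1)%:E <= Fav a b gamma (thicken E delta))%E)].
Proof.
have quarter : 0 < 4^-1 :> R /\ 4^-1 < 2^-1 :> R by split; lra.
have [[p [q [g [pq C2g curved [c00 cA ASigma HA]]]]]|noSigma] := pselect (exists p q g,
    [/\ p < q, C2_on p q g, forall x, x \in `[p, q] ->
        c0 <= `|derive_on p q (derive_on p q g) x|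
      & [/\ 0 < c0, compact A, A `<=` graph_on p q g & (0 < hausdorff1 A)%E]]);
  last first.
  exists 1, 4^-1; split; [exact: ltr01|exact: quarter.1|exact: quarter.2|].
  move=> a b gamma _ _ [c00 cA AS HA [p [q [g [pq C2g SE curved]]]]].
  exfalso; apply: noSigma; exists p, q, g; split => //; split => //.
  by rewrite -SE => x /AS[].
have [kappa kappa0 favA] := fav_lower_bound pq c00 C2g curved cA ASigma HA.
(* the energy bound needs a nonnegative constant *)
pose C := Num.max Cmu 0.
have C0 : 0 <= C by rewrite le_max lexx orbT.
have [B B0 energy] := dyadic_energy_bound C0 s_le1.
exists (kappa / B), 4^-1; split; [exact: divr_gt0|exact: quarter.1|exact: quarter.2|].
move=> a b gamma _ _ [_ _ AG _ _] E mu cE muE muC delta d0 d4.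
have d2 : delta < 2^-1 by apply: lt_trans d4 quarter.2.
have muC' : upper_regular mu C s.
  move=> x r r0 r1; apply: le_trans (muC x r r0 r1) _.
  by rewrite lee_fin ler_wpM2r ?powR_ge0// le_max lexx.
have [N [dN subcrit crit]] := energy delta d0 d2.
have AGgamma : A `<=` graph_on a b gamma by move=> x /AG[].
have := favA a b gamma AGgamma E mu C s cE muE muC' C0 delta N d0 dN.
set e := 1 + _ in subcrit crit * => fav_e.
have e0 : 0 < e.
  apply: ltr_wpDr => //; apply: mulr_ge0; first exact: mulr_ge0.
  by apply: sumr_ge0 => k _; rewrite exprn_ge0// powR_ge0.
split=> [s1|s1]; apply: le_trans fav_e; rewrite lee_fin -[leLHS]mulrA ler_pM2l//.
- have de0 : 0 < delta `^ (1 - s) by exact: powR_gt0.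
  rewrite -[_ `^ _]invrK -invfM lef_pV2 ?posrE ?divr_gt0//; exact: subcrit.
- rewrite -invfM lef_pV2 ?posrE//; first exact: crit.
  exact: lt_le_trans e0 (crit s1).
Qed.
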